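(* Let $C_1$ and $C_2$ be two confocal quadrics in $\mathbb{R}^3$. Suppose $a_1\in C_1$, $a_2\in C_2$, $a_3\in C_1$ and $a_4\in C_2$. For points $p,q$ write $pq$ for the length of the segment joining them. (a) If $C_1$ is connected and $a_2,a_4$ lie in the same connected component of $C_2$, then $$a_1a_2+a_3a_4=a_2a_3+a_1a_4.$$ (b) If $C_1$ is connected and $a_2,a_4$ lie in different connected components of $C_2$, then $$a_1a_2+a_1a_4=a_2a_3+a_3a_4.$$
   Context: Here a ''quadric'' is a planar conic curve lying in a plane of $\mathbb{R}^3$. Two conics lying in orthogonal planes and having the same axis are called confocal (confocal quadrics) if the foci of each of them lie on the other. In suitable Cartesian coordinates such a pair is one of the following (the two members of the pair may be taken in either order): - an ellipse in the $xz$-plane and a hyperbola in the $yz$-plane, $$\frac{z^2}{a^2}+\frac{x^2}{b^2}=1\ (y=0),\qquad \frac{z^2}{a^2-b^2}-\frac{y^2}{b^2}=1\ (x=0),\qquad a>b>0;$$ - two parabolas, $$z=\frac{x^2}{4a}-\frac a2\ (y=0),\qquad z=-\frac{y^2}{4a}+\frac a2\ (x=0),\qquad a>0.$$ The hyperbola here is the whole conic, with its two branches as connected components. *)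

(* Defs.v *)
From HB Require Import structures.
From mathcomp Require Import all_boot all_order all_algebra.
From mathcomp Require Import all_classical all_reals all_analysis.

Set Implicit Arguments.
Unset Strict Implicit.
Unset Printing Implicit Defensive.

Import Order.TTheory GRing.Theory Num.Theory.
Import numFieldNormedType.Exports.

Local Open Scope classical_set_scope.
Local Open Scope ring_scope.

(* The library norm on row vectors is the sup norm, hence an explicit
   Euclidean structure on R^3. Both norms induce the same topology, so
   [connected] and [connected_component] have their usual meaning. *)
Definition dot3 (R : realType) (p q : 'rV[R]_3) : R := \sum_(i < 3) p 0 i * q 0 i.

Definition dist3 (R : realType) (p q : 'rV[R]_3) : R :=
  Num.sqrt (dot3 (p - q) (p - q)).

(* Nondegenerate conics in the plane with coordinates (s, t), placed so that the
   focal axis is the s-axis, with the centre (for a parabola, the vertex) at the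
   origin. [Parabola a] has focal distance a. Circles are excluded: they have no
   focal axis. *)
Inductive conic_shape (R : realType) :=
  | Ellipse of R & R
  | Hyperbola of R & R
  | Parabola of R.

Definition shape_ok (R : realType) (k : conic_shape R) : Prop :=
  match k with
  | Ellipse a b => 0 < b /\ b < a
  | Hyperbola a b => 0 < a /\ 0 < b
  | Parabola a => 0 < a
  end.

Definition shape_eq (R : realType) (k : conic_shape R) (s t : R) : Prop :=
  match k with
  | Ellipse a b => s ^+ 2 / a ^+ 2 + t ^+ 2 / b ^+ 2 = 1
  | Hyperbola a b => s ^+ 2 / a ^+ 2 - t ^+ 2 / b ^+ 2 = 1
  | Parabola a => s = t ^+ 2 / (4 * a)
  end.

(* s-coordinates of the foci; their t-coordinate is 0. *)
Definition shape_foci (R : realType) (k : conic_shape R) : set R :=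
  match k with
  | Ellipse a b => [set Num.sqrt (a ^+ 2 - b ^+ 2); - Num.sqrt (a ^+ 2 - b ^+ 2)]
  | Hyperbola a b =>
      [set Num.sqrt (a ^+ 2 + b ^+ 2); - Num.sqrt (a ^+ 2 + b ^+ 2)]
  | Parabola a => [set a]
  end.

(* A conic in R^3: a shape drawn in the plane through [origin] spanned by the
   orthonormal vectors [axis_dir] (the s-direction) and [conj_dir] (the
   t-direction). *)
Record conic (R : realType) := Conic {
  origin : 'rV[R]_3;
  axis_dir : 'rV[R]_3;
  conj_dir : 'rV[R]_3;
  shape : conic_shape R;
  axis_dir_unit : dot3 axis_dir axis_dir = 1;
  conj_dir_unit : dot3 conj_dir conj_dir = 1;
  axis_conj_orthogonal : dot3 axis_dir conj_dir = 0;
  conic_shape_ok : shape_ok shape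
}.

Definition conic_point (R : realType) (C : conic R) (s t : R) : 'rV[R]_3 :=
  origin C + s *: axis_dir C + t *: conj_dir C.

Definition curve (R : realType) (C : conic R) : set 'rV[R]_3 :=
  [set p | exists s t : R, shape_eq (shape C) s t /\ p = conic_point C s t].

Definition focal_axis (R : realType) (C : conic R) : set 'rV[R]_3 :=
  [set p | exists s : R, p = conic_point C s 0].

Definition foci (R : realType) (C : conic R) : set 'rV[R]_3 :=
  [set p | exists2 s : R, shape_foci (shape C) s & p = conic_point C s 0].

Definition plane_normal (R : realType) (C : conic R) (n : 'rV[R]_3) : Prop :=
  dot3 n (axis_dir C) = 0 /\ dot3 n (conj_dir C) = 0.

Definition orthogonal_planes (R : realType) (C1 C2 : conic R) : Prop :=
  forall n1 n2 : 'rV[R]_3,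
    plane_normal C1 n1 -> plane_normal C2 n2 -> dot3 n1 n2 = 0.

Definition confocal (R : realType) (C1 C2 : conic R) : Prop :=
  [/\ orthogonal_planes C1 C2,
      focal_axis C1 = focal_axis C2,
      foci C1 `<=` curve C2
    & foci C2 `<=` curve C1].

(* Main.v *)
(* Choose coordinates along the common axis of the two conics. The focal
   conditions say that the foci of each are vertices of the other, which leaves
   an ellipse with a hyperbola, or two parabolas (a pair of ellipses would need
   each linear eccentricity to equal the other's larger semi-axis). In both
   cases the squared distance between a point [p] of [C1] and a point [q] of [C2]
   is a perfect square, and the distance splits as [f q - sg q * g p], where
   [sg q] is constant on the components of [C2]: it is the sign of the branch
   for a hyperbola, and there is only one component for a parabola. Both
   identities are then immediate. *)
Require Import Defs.
From HB Require Import structures.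
From mathcomp Require Import all_boot all_order all_algebra.
From mathcomp Require Import all_classical all_reals all_analysis.
From mathcomp Require Import ring lra.
Import Order.TTheory GRing.Theory Num.Theory.
Import numFieldNormedType.Exports.
Local Open Scope classical_set_scope.
Local Open Scope ring_scope.

Set Implicit Arguments.
Unset Strict Implicit.

(** * Euclidean identities for dot and cross products *)

Lemma dot3E (R : realType) (p q : 'rV[R]_3) :
  dot3 p q = p 0 0 * q 0 0 + p 0 1 * q 0 1 + p 0 2%:R * q 0 2%:R.
Proof.
rewrite /dot3 !big_ord_recl big_ord0 addr0 addrA.
by congr (_ + _ * _ + _ * _); congr (_ 0 _); apply/val_inj.
Qed.

Lemma dot3C (R : realType) (p q : 'rV[R]_3) : dot3 p q = dot3 q p.
Proof. by rewrite !dot3E; ring. Qed.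

Lemma dot3Dl (R : realType) (p q r : 'rV[R]_3) :
  dot3 (p + q) r = dot3 p r + dot3 q r.
Proof. by rewrite !dot3E !mxE; ring. Qed.

Lemma dot3Zl (R : realType) (a : R) (p q : 'rV[R]_3) :
  dot3 (a *: p) q = a * dot3 p q.
Proof. by rewrite !dot3E !mxE; ring. Qed.

Lemma dot3Zr (R : realType) (a : R) (p q : 'rV[R]_3) :
  dot3 p (a *: q) = a * dot3 p q.
Proof. by rewrite dot3C dot3Zl dot3C. Qed.

Lemma dot3_orthonormal_sqr (R : realType) (u v w : 'rV[R]_3) (a b c : R) :
  dot3 u u = 1 -> dot3 v v = 1 -> dot3 w w = 1 ->
  dot3 u v = 0 -> dot3 u w = 0 -> dot3 v w = 0 ->
  dot3 (a *: u + b *: v + c *: w) (a *: u + b *: v + c *: w) =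
  a ^+ 2 + b ^+ 2 + c ^+ 2.
Proof.
move=> uu vv ww uv uw vw.
have -> : a ^+ 2 + b ^+ 2 + c ^+ 2 =
    a ^+ 2 * dot3 u u + b ^+ 2 * dot3 v v + c ^+ 2 * dot3 w w +
    2 * a * b * dot3 u v + 2 * a * c * dot3 u w + 2 * b * c * dot3 v w.
  by rewrite uu vv ww uv uw vw; ring.
by rewrite !dot3E !mxE; ring.
Qed.

(** Indices in ['I_3] add modulo 3, so one cyclic formula covers the three coordinates. *)
Definition cross3 (R : realType) (p q : 'rV[R]_3) : 'rV[R]_3 :=
  \row_(j < 3) (p 0 (j + 1) * q 0 (j + 2%:R) - p 0 (j + 2%:R) * q 0 (j + 1)).

Lemma cross3E (R : realType) (p q : 'rV[R]_3) :
  [/\ cross3 p q 0 0 = p 0 1 * q 0 2%:R - p 0 2%:R * q 0 1,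
      cross3 p q 0 1 = p 0 2%:R * q 0 0 - p 0 0 * q 0 2%:R
    & cross3 p q 0 2%:R = p 0 0 * q 0 1 - p 0 1 * q 0 0].
Proof.
by split; rewrite mxE; congr (_ * _ - _ * _); congr (_ 0 _); apply/val_inj.
Qed.

(** The Binet-Cauchy identity. It turns orthogonality of two plane normals into relations between
    the direction vectors. *)
Lemma dot3_cross3 (R : realType) (p q r s : 'rV[R]_3) :
  dot3 (cross3 p q) (cross3 r s) =
  dot3 p r * dot3 q s - dot3 p s * dot3 q r.
Proof.
rewrite !dot3E; have [-> -> ->] := cross3E p q.
by have [-> -> ->] := cross3E r s; ring.
Qed.

Lemma plane_normal_cross3 (R : realType) (C : conic R) :
  plane_normal C (cross3 (axis_dir C) (conj_dir C)).
Proof.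
by split; rewrite dot3E; have [-> -> ->] := cross3E (axis_dir C) (conj_dir C);
  ring.
Qed.

(** * Coordinates on a conic *)

Definition axis_coord (R : realType) (C : conic R) (p : 'rV[R]_3) : R :=
  dot3 (p - origin C) (axis_dir C).

Lemma axis_coord_conic_point (R : realType) (C : conic R) (s t : R) :
  axis_coord C (conic_point C s t) = s.
Proof.
rewrite /axis_coord.
have -> : conic_point C s t - origin C = s *: axis_dir C + t *: conj_dir C.
  by rewrite /conic_point; apply/rowP => i; rewrite !mxE; ring.
rewrite dot3Dl !dot3Zl axis_dir_unit.
by rewrite [dot3 (conj_dir C) _]dot3C axis_conj_orthogonal; ring.
Qed.

Lemma continuous_axis_coord (R : realType) (C : conic R) :
  continuous (axis_coord C).
Proof.
(* On ['rV[R]_3] itself the filter instance required by [cvgD] and [cvgM] is not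
   inferred, hence the detour through an abstract [T]. *)
have subM (T : topologicalType) (f : T -> R) (a b : R) :
    continuous f -> continuous (fun q => (f q - a) * b).
  move=> cf q; apply: cvgM; last exact: cvg_cst.
  by apply: cvgB; [exact: cf | exact: cvg_cst].
have add (T : topologicalType) (f g : T -> R) :
    continuous f -> continuous g -> continuous (fun q => f q + g q).
  by move=> cf cg q; apply: cvgD; [exact: cf | exact: cg].
have -> : axis_coord C = (fun q : 'rV[R]_3 =>
    (q 0 0 - origin C 0 0) * axis_dir C 0 0 +
    (q 0 1 - origin C 0 1) * axis_dir C 0 1 +
    (q 0 2%:R - origin C 0 2%:R) * axis_dir C 0 2%:R).
  by apply/funext => q; rewrite /axis_coord dot3E !mxE.
have c (i : 'I_3) (a b : R) : continuous (fun q : 'rV[R]_3 => (q 0 i - a) * b).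
  by apply: subM; exact: coord_continuous.
exact: (add _ _ _ (add _ _ _ (c 0 _ _) (c 1 _ _)) (c 2%:R _ _)).
Qed.

Lemma conic_point_inj (R : realType) (C : conic R) (s t s' t' : R) :
  conic_point C s t = conic_point C s' t' -> s = s' /\ t = t'.
Proof.
move=> E; have ss' : s = s'.
  by rewrite -(axis_coord_conic_point C s t) E axis_coord_conic_point.
split=> //; move: E; rewrite ss' /conic_point => /addrI E.
have := congr1 (fun p => dot3 p (conj_dir C)) E.
by rewrite !dot3Zl conj_dir_unit !mulr1.
Qed.

Lemma curve_conic_point (R : realType) (C : conic R) (s t : R) :
  curve C (conic_point C s t) -> shape_eq (Defs.shape C) s t.
Proof. by move=> [s' [t' [+ /conic_point_inj [-> ->]]]]. Qed.

(** * Connectedness, by viewing curves as graphs over the conjugate axis *)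

Lemma connected_graph (R : realType) (C : conic R) (f : R -> R) :
  continuous f -> connected ((fun t => conic_point C (f t) t) @` setT).
Proof.
move=> cf; apply: connected_continuous_connected.
  by apply/connected_intervalP.
apply: continuous_subspaceT => t; rewrite /conic_point.
apply: cvgD; last exact: scalel_continuous.
by apply: cvgD; [exact: cvg_cst | apply: cvgZr_tmp; exact: cf].
Qed.

Lemma parabola_connected (R : realType) (C : conic R) (a : R) :
  Defs.shape C = Parabola a -> connected (curve C).
Proof.
move=> sh.
have -> : curve C = (fun t => conic_point C (t ^+ 2 / (4 * a)) t) @` setT.
  apply/seteqP; split=> [p [s [t [+ ->]]]|p [t _ <-]].
    by rewrite sh /= => ->; exists t.
  by exists (t ^+ 2 / (4 * a)), t; rewrite sh.
apply: connected_graph => t.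
by apply: cvgM; [exact: exprn_continuous | exact: cvg_cst].
Qed.

(** The axis coordinate maps [B] onto an interval. A change of sign would put 0 in it, but no point
    of the hyperbola has [s = 0]. *)
Lemma hyperbola_connected_subset (R : realType) (C : conic R) (a b : R)
    (B : set 'rV[R]_3) (p q : 'rV[R]_3) :
  Defs.shape C = Hyperbola a b -> connected B -> B `<=` curve C -> B p -> B q ->
  0 < axis_coord C p -> 0 < axis_coord C q.
Proof.
move=> sh cB BC Bp Bq p0; rewrite ltNge; apply/negP => q0.
have /connected_intervalP iB : connected (axis_coord C @` B).
  apply: connected_continuous_connected => //.
  exact/continuous_subspaceT/continuous_axis_coord.
have [|||r /BC[s [t [+ ->]]]] := iB (axis_coord C q) (axis_coord C p) _ _ 0 _.
- by exists q.
- by exists p.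
- by rewrite q0 ltW.
rewrite axis_coord_conic_point sh /= => + s0; rewrite s0.
have := sqr_ge0 (t / b); rewrite expr_div_n; lra.
Qed.

(** The vertices at [a] and [- a] have axis coordinates of opposite signs. *)
Lemma hyperbola_not_connected (R : realType) (C : conic R) (a b : R) :
  Defs.shape C = Hyperbola a b -> ~ connected (curve C).
Proof.
move=> sh cC.
have [a0 _] : 0 < a /\ 0 < b by have := conic_shape_ok C; rewrite sh.
have vtx (s : R) : s ^+ 2 = a ^+ 2 -> curve C (conic_point C s 0).
  move=> sa; exists s, 0; split=> //; rewrite sh /= sa.
  by rewrite divff ?expf_neq0 ?gt_eqF// expr0n mul0r subr0.
have := hyperbola_connected_subset sh cC (@subset_refl _ _)
  (vtx a erefl) (vtx (- a) (sqrrN a)).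
by rewrite !axis_coord_conic_point => /(_ a0); lra.
Qed.

(** The factor [sg], equal to 1 or -1, names the branch. Solving the equation for [s] shows that
    this branch is the graph of the continuous function [f] below, hence connected. *)
Lemma hyperbola_branch_component (R : realType) (C : conic R) (a b sg s t s' t' : R) :
  Defs.shape C = Hyperbola a b -> sg ^+ 2 = 1 ->
  shape_eq (Defs.shape C) s t -> shape_eq (Defs.shape C) s' t' ->
  0 < sg * s -> 0 < sg * s' ->
  connected_component (curve C) (conic_point C s t) (conic_point C s' t').
Proof.
move=> sh sg1 e e' s0 s0'.
have [a0 b0] : 0 < a /\ 0 < b by have := conic_shape_ok C; rewrite sh.
have aN0 : a != 0 by rewrite gt_eqF.
have bN0 : b != 0 by rewrite gt_eqF.
have sqrt1 (x : R) : Num.sqrt (1 + (x / b) ^+ 2) ^+ 2 = 1 + (x / b) ^+ 2.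
  by rewrite sqr_sqrtr// addr_ge0// sqr_ge0.
pose f x := sg * a * Num.sqrt (1 + (x / b) ^+ 2).
have onf (x y : R) : shape_eq (Defs.shape C) x y -> 0 < sg * x -> x = f y.
  rewrite sh /= -!expr_div_n => E x0.
  rewrite /f; have -> : 1 + (y / b) ^+ 2 = (sg * x / a) ^+ 2.
    have -> : (sg * x / a) ^+ 2 = sg ^+ 2 * (x / a) ^+ 2 by field.
    by rewrite sg1; lra.
  rewrite sqrtr_sqr gtr0_norm; last by rewrite divr_gt0.
  have -> : sg * a * (sg * x / a) = sg ^+ 2 * x by field.
  by rewrite sg1 mul1r.
apply: (connected_component_max _ _ (connected_graph (C := C) (f := f) _)).
- by exists t => //; rewrite -(onf s t).
- move=> _ [y _ <-]; exists (f y), y; split=> //; rewrite sh /= /f.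
  have -> x : (sg * a * x) ^+ 2 / a ^+ 2 = sg ^+ 2 * x ^+ 2 by field.
  by rewrite sg1 sqrt1 expr_div_n; ring.
- move=> x; apply: cvgM; first exact: cvg_cst.
  apply: (@continuous_comp _ _ _ (fun x : R => 1 + (x / b) ^+ 2) Num.sqrt);
    last exact: sqrt_continuous.
  apply: cvgD; first exact: cvg_cst.
  apply: (@continuous_comp _ _ _ (fun x : R => x / b) (fun x => x ^+ 2));
    last exact: exprn_continuous.
  by apply: cvgM; [exact: cvg_id | exact: cvg_cst].
- by exists t' => //; rewrite -(onf s' t').
Qed.

(** * Relative position of two confocal conics *)

(* [C2] in the coordinates of [C1]: the axis is reversed when [e = -1], and the
   origin is moved by [k] along it. *)
Definition aligned (R : realType) (C1 C2 : conic R) (e k : R) : Prop :=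
  [/\ e ^+ 2 = 1, axis_dir C2 = e *: axis_dir C1,
      origin C2 = origin C1 + k *: axis_dir C1
    & dot3 (conj_dir C1) (conj_dir C2) = 0].

(** The points of parameters 0 and 1 on the axis of [C2] have parameters [k] and [l] on that of
    [C1], and [e] is [l - k]. Unit length gives [e ^+ 2 = 1]; the cross products, as normals, give
    orthogonality of the conjugate directions. *)
Lemma confocal_aligned (R : realType) (C1 C2 : conic R) :
  confocal C1 C2 -> exists e k : R, aligned C1 C2 e k.
Proof.
move=> [orth axes _ _].
have onaxis (s : R) : exists r, conic_point C2 s 0 = conic_point C1 r 0.
  by have : focal_axis C1 (conic_point C2 s 0) by rewrite axes; exists s.
have [k] := onaxis 0; have [l] := onaxis 1.
rewrite /conic_point !scale0r !addr0 scale1r => E1 E0.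
have ax : axis_dir C2 = (l - k) *: axis_dir C1.
  by rewrite scalerBl -[LHS](addKr (origin C2)) E1 E0 opprD addrACA addNr add0r addrC.
have e1 : (l - k) ^+ 2 = 1.
  have := axis_dir_unit C2; rewrite ax dot3Zl dot3Zr axis_dir_unit => <-; ring.
exists (l - k), k; split=> //.
have := orth _ _ (plane_normal_cross3 C1) (plane_normal_cross3 C2).
rewrite dot3_cross3 ax !dot3Zr axis_dir_unit.
rewrite [dot3 (conj_dir C1) (axis_dir C1)]dot3C axis_conj_orthogonal.
rewrite !mulr0 subr0 mulr1 => /eqP; rewrite mulf_eq0 => /orP[/eqP l0|/eqP//].
by move: e1; rewrite l0 expr0n => /esym/eqP; rewrite oner_eq0.
Qed.

Lemma aligned_axis_point (R : realType) (C1 C2 : conic R) (e k s : R) :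
  aligned C1 C2 e k -> conic_point C2 s 0 = conic_point C1 (k + e * s) 0.
Proof.
move=> [_ ax o _]; rewrite /conic_point !scale0r !addr0 ax o scalerA scalerDl.
by rewrite addrA [s * e]mulrC.
Qed.

(** Foci lie on the common axis, so each incidence becomes an equation at [t = 0]: the focus is a
    vertex of the other conic. *)
Lemma aligned_foci (R : realType) (C1 C2 : conic R) (e k : R) :
  confocal C1 C2 -> aligned C1 C2 e k ->
  (forall f, shape_foci (Defs.shape C1) f -> shape_eq (Defs.shape C2) (e * (f - k)) 0) /\
  (forall f, shape_foci (Defs.shape C2) f -> shape_eq (Defs.shape C1) (k + e * f) 0).
Proof.
move=> [_ _ F12 F21] al; have [e1 _ _ _] := al.
split=> f ff; apply: curve_conic_point.
  rewrite (aligned_axis_point _ al).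
  have -> : k + e * (e * (f - k)) = k + e ^+ 2 * (f - k) by ring.
  by rewrite e1 mul1r addrC subrK; apply: F12; exists f.
by rewrite -(aligned_axis_point _ al); apply: F21; exists f.
Qed.

(** The common axis direction and the two conjugate directions form an orthonormal frame. *)
Lemma aligned_dist (R : realType) (C1 C2 : conic R) (e k s t S T : R) :
  aligned C1 C2 e k ->
  dist3 (conic_point C1 s t) (conic_point C2 S T) =
  Num.sqrt ((s - k - e * S) ^+ 2 + t ^+ 2 + T ^+ 2).
Proof.
move=> [e1 ax o orth]; rewrite /dist3.
have -> : conic_point C1 s t - conic_point C2 S T =
    (s - k - e * S) *: axis_dir C1 + t *: conj_dir C1 + (- T) *: conj_dir C2.
  by rewrite /conic_point ax o; apply/rowP => i; rewrite !mxE; ring.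
rewrite dot3_orthonormal_sqr ?axis_dir_unit ?conj_dir_unit
  ?axis_conj_orthogonal ?sqrrN//.
have := axis_conj_orthogonal C2; rewrite ax dot3Zl => /eqP.
rewrite mulf_eq0 => /orP[/eqP e0|/eqP//].
by move: e1; rewrite e0 expr0n => /esym/eqP; rewrite oner_eq0.
Qed.

Lemma dist3C (R : realType) (p q : 'rV[R]_3) : dist3 p q = dist3 q p.
Proof. by rewrite /dist3; congr Num.sqrt; rewrite !dot3E !mxE; ring. Qed.

(** * Classification of confocal pairs *)

Lemma ellipse_vertex (R : realType) (a b s : R) :
  shape_ok (Ellipse a b) -> shape_eq (Ellipse a b) s 0 -> s ^+ 2 = a ^+ 2.
Proof.
move=> /= [b0 ba]; rewrite expr0n mul0r addr0 => /divr1_eq; exact.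
Qed.

Lemma hyperbola_vertex (R : realType) (a b s : R) :
  shape_ok (Hyperbola a b) -> shape_eq (Hyperbola a b) s 0 -> s ^+ 2 = a ^+ 2.
Proof.
move=> /= [a0 b0]; rewrite expr0n mul0r subr0 => /divr1_eq; exact.
Qed.

Lemma parabola_vertex (R : realType) (a s : R) :
  shape_eq (Parabola a) s 0 -> s = 0.
Proof. by move=> /= ->; rewrite expr0n mul0r. Qed.

(* Two points symmetric about the origin cannot be at equal distance from [k]
   unless [k = 0]: the centres coincide. *)
Lemma vertices_pm (R : realType) (e k c A : R) :
  e ^+ 2 = 1 -> 0 < c -> (e * (c - k)) ^+ 2 = A -> (e * (- c - k)) ^+ 2 = A ->
  k = 0 /\ c ^+ 2 = A.
Proof.
rewrite !exprMn => -> c0; rewrite !mul1r => h1 h2.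
have k0 : k = 0.
  have /eqP : c * k = 0 by lra.
  by rewrite mulf_eq0 gt_eqF//= => /eqP.
by split=> //; rewrite -h1 k0 subr0.
Qed.

(** Were [C2] an ellipse, its semi-axis [A] would satisfy both [A < a] and [a < A]. Were it a
    parabola, its single vertex would be both foci of [C1]. *)
Lemma confocal_ellipse (R : realType) (C1 C2 : conic R) (e k a b : R) :
  confocal C1 C2 -> aligned C1 C2 e k -> Defs.shape C1 = Ellipse a b ->
  k = 0 /\ exists A B, [/\ Defs.shape C2 = Hyperbola A B, A ^+ 2 = a ^+ 2 - b ^+ 2
    & B ^+ 2 = b ^+ 2].
Proof.
move=> hC al sh1; have [F12 F21] := aligned_foci hC al; have [e1 _ _ _] := al.
have ok1 := conic_shape_ok C1; have ok2 := conic_shape_ok C2.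
rewrite sh1 in F12 F21 ok1; have [b0 ba] := ok1.
have ab2 : b ^+ 2 < a ^+ 2 by rewrite ltr_pXn2r ?nnegrE ?ltW//; lra.
have c0 : 0 < Num.sqrt (a ^+ 2 - b ^+ 2) by rewrite sqrtr_gt0 subr_gt0.
have c2 : Num.sqrt (a ^+ 2 - b ^+ 2) ^+ 2 = a ^+ 2 - b ^+ 2.
  by rewrite sqr_sqrtr// subr_ge0 ltW.
have fp := F12 _ (or_introl erefl); have fm := F12 _ (or_intror erefl).
case sh2 : (Defs.shape C2) fp fm ok2 F21 => [A B|A B|A] fp fm ok2 F21.
- have [k0 cA] := vertices_pm e1 c0 (ellipse_vertex ok2 fp) (ellipse_vertex ok2 fm).
  have := ellipse_vertex ok1 (F21 _ (or_introl erefl)).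
  have [B0 BA] := ok2.
  have AB2 : B ^+ 2 < A ^+ 2 by rewrite ltr_pXn2r ?nnegrE ?ltW//; lra.
  rewrite k0 add0r exprMn e1 mul1r sqr_sqrtr ?subr_ge0 ?ltW//.
  have := exprn_gt0 2 b0; have := exprn_gt0 2 B0; lra.
- have [k0 cA] := vertices_pm e1 c0 (hyperbola_vertex ok2 fp) (hyperbola_vertex ok2 fm).
  have := ellipse_vertex ok1 (F21 _ (or_introl erefl)).
  rewrite k0 add0r exprMn e1 mul1r sqr_sqrtr ?addr_ge0 ?sqr_ge0// => AB.
  by split=> //; exists A, B; split=> //; lra.
- have /eqP := parabola_vertex fp; have /eqP := parabola_vertex fm.
  have eN0 : e != 0.
    by apply/eqP => e0; move: e1; rewrite e0 expr0n => /esym/eqP; rewrite oner_eq0.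
  rewrite !mulf_eq0 (negPf eN0) /= => /eqP ? /eqP ?; lra.
Qed.

(** A parabola has one vertex, which cannot be two distinct foci, so [C2] is a parabola. Then
    [k = a] and [a + e * A = 0], which excludes [e = 1]. *)
Lemma confocal_parabola (R : realType) (C1 C2 : conic R) (e k a : R) :
  confocal C1 C2 -> aligned C1 C2 e k -> Defs.shape C1 = Parabola a ->
  [/\ k = a, e = -1 & Defs.shape C2 = Parabola a].
Proof.
move=> hC al sh1; have [F12 F21] := aligned_foci hC al; have [e1 _ _ _] := al.
have ok1 := conic_shape_ok C1; have ok2 := conic_shape_ok C2.
rewrite sh1 /= in F12 F21 ok1.
have e01 : e = 1 \/ e = -1.
  by move/eqP: e1; rewrite sqrf_eq1 => /orP[] /eqP; [left | right].
case sh2 : (Defs.shape C2) F12 ok2 F21 => [A B|A B|A] F12 ok2 F21.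
- have [B0 BA] := ok2.
  have AB2 : B ^+ 2 < A ^+ 2 by rewrite ltr_pXn2r ?nnegrE ?ltW//; lra.
  have : 0 < Num.sqrt (A ^+ 2 - B ^+ 2) by rewrite sqrtr_gt0 subr_gt0.
  have := parabola_vertex (F21 _ (or_introl erefl)).
  have := parabola_vertex (F21 _ (or_intror erefl)).
  by case: e01 => ->; lra.
- have [A0 B0] := ok2.
  have : 0 < Num.sqrt (A ^+ 2 + B ^+ 2) by rewrite sqrtr_gt0 addr_gt0 ?exprn_gt0.
  have := parabola_vertex (F21 _ (or_introl erefl)).
  have := parabola_vertex (F21 _ (or_intror erefl)).
  by case: e01 => ->; lra.
- have := parabola_vertex (F21 _ erefl); have := parabola_vertex (F12 _ erefl).
  move: ok2 => /= A0; case: e01 => -> h h'; first by clear - ok1 A0 h h'; lra.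
  by have -> : A = a by [lra]; split=> //; lra.
Qed.

(** * Distance formulas *)

(* The squared distance between a point of the ellipse and a point of the
   hyperbola is a perfect square; [sg] selects the branch. *)
Lemma ellipse_hyperbola_dist (R : realType) (a b A e sg s t S T : R) :
  0 < b -> 0 < A -> 0 < a -> A ^+ 2 = a ^+ 2 - b ^+ 2 ->
  s ^+ 2 / a ^+ 2 + t ^+ 2 / b ^+ 2 = 1 ->
  S ^+ 2 / A ^+ 2 - T ^+ 2 / b ^+ 2 = 1 ->
  e ^+ 2 = 1 -> sg ^+ 2 = 1 -> 0 < sg * S ->
  Num.sqrt ((s - e * S) ^+ 2 + t ^+ 2 + T ^+ 2) =
  sg * S * a / A - sg * (e * s * A / a).
Proof.
move=> b0 A0 a0 Aab E H e1 sg1 S0.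
have bN0 : b != 0 by rewrite gt_eqF.
have aN0 : a != 0 by rewrite gt_eqF.
have AN0 : A != 0 by rewrite gt_eqF.
(* Up to sign, [x] and [y] are the cosh and cos of the usual parametrisations; [sg] makes [x]
   positive. *)
pose x := sg * S / A; pose y := sg * e * s / a.
have x2 : x ^+ 2 = 1 + T ^+ 2 / b ^+ 2.
  have -> : x ^+ 2 = sg ^+ 2 * (S ^+ 2 / A ^+ 2) by rewrite /x; field.
  by rewrite sg1; lra.
have y2 : y ^+ 2 = 1 - t ^+ 2 / b ^+ 2.
  have -> : y ^+ 2 = sg ^+ 2 * e ^+ 2 * (s ^+ 2 / a ^+ 2) by rewrite /y; field.
  by rewrite sg1 e1; lra.
have -> : sg * S * a / A - sg * (e * s * A / a) = a * x - A * y.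
  by rewrite /x /y; field; rewrite aN0 AN0.
have -> : (s - e * S) ^+ 2 + t ^+ 2 + T ^+ 2 = (a * x - A * y) ^+ 2.
  have -> : t ^+ 2 = b ^+ 2 * (1 - y ^+ 2) by rewrite y2; field.
  have -> : T ^+ 2 = b ^+ 2 * (x ^+ 2 - 1) by rewrite x2; field.
  have -> : (s - e * S) ^+ 2 = (a * y - A * x) ^+ 2.
    have -> : a * y - A * x = sg * (e * s - S) by rewrite /x /y; field; rewrite aN0 AN0.
    have -> : (sg * (e * s - S)) ^+ 2 = sg ^+ 2 * (e ^+ 2 * s ^+ 2 - 2 * e * s * S + S ^+ 2).
      by ring.
    by rewrite sg1 e1 sqrrB exprMn e1; ring.
  have -> : b ^+ 2 = a ^+ 2 - A ^+ 2 by rewrite Aab; ring.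
  by ring.
rewrite sqrtr_sqr ger0_norm//.
(* The sign follows from [a * x >= a >= A >= A * y]. *)
have x0 : 0 < x by rewrite divr_gt0.
have x1 : 1 <= x by have := sqr_ge0 (T / b); rewrite expr_div_n; nra.
have y1 : y <= 1 by have := sqr_ge0 (t / b); rewrite expr_div_n; nra.
have Aa : A <= a by nra.
by nra.
Qed.

(** Replacing [t ^+ 2] by [4 * a * s] and [T ^+ 2] by [4 * a * S] makes the radicand a perfect
    square. *)
Lemma parabola_parabola_dist (R : realType) (a s t S T : R) :
  0 < a -> s = t ^+ 2 / (4 * a) -> S = T ^+ 2 / (4 * a) ->
  Num.sqrt ((s - a + S) ^+ 2 + t ^+ 2 + T ^+ 2) = s + S + a.
Proof.
move=> a0 hs hS; have aN0 : a != 0 by rewrite gt_eqF.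
have s0 : 0 <= s by rewrite hs divr_ge0 ?sqr_ge0//; lra.
have S0 : 0 <= S by rewrite hS divr_ge0 ?sqr_ge0//; lra.
have -> : t ^+ 2 = 4 * a * s by rewrite hs; field.
have -> : T ^+ 2 = 4 * a * S by rewrite hS; field.
have -> : (s - a + S) ^+ 2 + 4 * a * s + 4 * a * S = (s + S + a) ^+ 2 by ring.
by rewrite sqrtr_sqr ger0_norm//; lra.
Qed.

Unset Implicit Arguments.

Theorem theorem2p1 (R : realType) (C1 C2 : conic R) (hC : confocal C1 C2)
    (a1 a2 a3 a4 : 'rV[R]_3)
    (h1 : curve C1 a1) (h2 : curve C2 a2) (h3 : curve C1 a3) (h4 : curve C2 a4) :
  (connected (curve C1) -> connected_component (curve C2) a2 a4 ->
     dist3 a1 a2 + dist3 a3 a4 = dist3 a2 a3 + dist3 a1 a4) /\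
  (connected (curve C1) -> ~ connected_component (curve C2) a2 a4 ->
     dist3 a1 a2 + dist3 a1 a4 = dist3 a2 a3 + dist3 a3 a4).
Proof.
have [e [k al]] := confocal_aligned hC; have [e1 _ _ _] := al.
case: h1 h2 h3 h4 => [s1 [t1 [E1 ->]]] [s2 [t2 [E2 ->]]] [s3 [t3 [E3 ->]]]
  [s4 [t4 [E4 ->]]].
rewrite (dist3C (conic_point C2 s2 t2)) !(aligned_dist _ _ _ _ al).
case sh1 : (Defs.shape C1) (E1) (E3) => [a b|a b|a].
- have [k0 [A [B [sh2 A2 B2]]]] := confocal_ellipse hC al sh1.
  have [b0 ba] : 0 < b /\ b < a by have := conic_shape_ok C1; rewrite sh1.
  have [A0 B0] : 0 < A /\ 0 < B by have := conic_shape_ok C2; rewrite sh2.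
  rewrite /= => E1' E3'; have [E2' E4'] := (E2, E4).
  rewrite sh2 /= B2 in E2' E4'.
  have dist := ellipse_hyperbola_dist b0 A0 (lt_trans b0 ba) A2.
  have sgn s t : s ^+ 2 / A ^+ 2 - t ^+ 2 / b ^+ 2 = 1 ->
      0 < Num.sg s * s /\ Num.sg s ^+ 2 = 1.
    move=> E; have sN0 : s != 0.
      apply/eqP => s0; move: E; rewrite s0.
      have := sqr_ge0 (t / b); rewrite expr_div_n; lra.
    by rewrite -normrEsg normr_gt0 sqr_sg sN0.
  have [p2 g2] := sgn _ _ E2'; have [p4 g4] := sgn _ _ E4'.
  have cc sg : sg ^+ 2 = 1 -> 0 < sg * s2 -> 0 < sg * s4 -> connected_component
      (curve C2) (conic_point C2 s2 t2) (conic_point C2 s4 t4).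
    by move=> h; exact: (hyperbola_branch_component sh2 h E2 E4).
  rewrite k0 !subr0.
  rewrite !(dist e (Num.sg s2) _ _ s2 t2)// !(dist e (Num.sg s4) _ _ s4 t4)//.
  have pm (x : R) : x ^+ 2 = 1 -> x = 1 \/ x = -1.
    by move/eqP; rewrite sqrf_eq1 => /orP[] /eqP; [left | right].
  split=> _ hcc.
  (* With equal signs, both sides carry the same terms in [s1] and [s3]. A component is connected,
     so it cannot meet both branches. *)
  + suff -> : Num.sg s4 = Num.sg s2 by ring.
    have [Bp Bc Bq] : [/\ connected_component (curve C2) (conic_point C2 s2 t2)
          (conic_point C2 s2 t2),
        connected (connected_component (curve C2) (conic_point C2 s2 t2))
      & connected_component (curve C2) (conic_point C2 s2 t2) `<=` curve C2].
      split; [|exact: component_connected|exact: connected_component_sub].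
      by apply: connected_component_refl; exists s2, t2.
    have := hyperbola_connected_subset sh2 Bc Bq Bp hcc.
    have := hyperbola_connected_subset sh2 Bc Bq hcc Bp.
    rewrite !axis_coord_conic_point.
    move: p2 p4.
    case: (pm _ g2) => ->; case: (pm _ g4) => -> //; rewrite !mulN1r !mul1r
      !oppr_gt0 => p2 p4 i42 i24.
      by have := i24 p2; lra.
    by have := i42 p4; lra.
  (* With opposite signs, the terms in [s1] cancel on the left and those in [s3] on the right. Equal
     signs would put both points on one branch. *)
  + suff -> : Num.sg s4 = - Num.sg s2 by ring.
    case: (pm _ g2) => sg2; case: (pm _ g4) => sg4; rewrite sg2 sg4 ?opprK//.
      by case: hcc; apply: (cc 1); rewrite ?expr1n// -?sg2// sg2 -sg4.
    by case: hcc; apply: (cc (-1)); rewrite ?sqrrN ?expr1n// -?sg2// sg2 -sg4.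
(* Both claims are vacuous here, since a hyperbola is not connected. *)
- by move=> _ _; split=> /(hyperbola_not_connected sh1).
- have [ka eN1 sh2] := confocal_parabola hC al sh1.
  have a0 : 0 < a by have := conic_shape_ok C1; rewrite sh1.
  rewrite sh2 in E2 E4; move=> E1' E3'.
  rewrite ka eN1 !mulN1r !opprK !(parabola_parabola_dist a0)//.
  split=> [_ _|_ hcc]; first lra.
  (* A parabola is a single component, so (b) is vacuous. *)
  exfalso; apply: hcc; rewrite (connected_component_id _ (parabola_connected sh2)).
    by exists s4, t4; rewrite sh2.
  by exists s2, t2; rewrite sh2.
Qed.
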